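(* Let $b,c\in\mathbb{Z}$ with $b\neq0$ and $d=b^2-4c\neq0$, and let $n$ be a positive integer. Then $$b\,\frac{n(n+1)}{2}\ \Big|\ \sum_{k=1}^n kT_k(b,c)T_{k-1}(b,c)d^{n-k},\qquad b\,\frac{n^2(n+1)^2}{4}\ \Big|\ 3\sum_{k=1}^n k^3T_k(b,c)T_{k-1}(b,c)d^{n-k}.$$ Also, $$\frac{(2,n)}{n(n+1)(n+2)}\sum_{k=0}^{n-1}(k+1)(k+2)(2k+3)M_k(b,c)^2d^{n-1-k}\in\mathbb{Z}$$ and $$\sum_{k=0}^{n-1}\frac{(k+1)(k+2)(2k+3)}{n(n+1)(n+2)}M_k(b,c)^2(-d)^{n-1-k}=\frac{M_n(b,c)M_{n-1}(b,c)}{b}\in\mathbb{Z},$$ where $(2,n)$ denotes the greatest common divisor of $2$ and $n$.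
   Context: For $b,c\in\mathbb{Z}$ and $n\in\mathbb{N}$, the generalized central trinomial coefficient $T_n(b,c)$ is the coefficient of $x^n$ in $(x^2+bx+c)^n$, i.e. $T_n(b,c)=\sum_{k=0}^{\lfloor n/2\rfloor}\binom{n}{2k}\binom{2k}{k}b^{n-2k}c^k$, and the generalized Motzkin number is $M_n(b,c)=\sum_{k=0}^{\lfloor n/2\rfloor}\binom{n}{2k}C_kb^{n-2k}c^k$, where $C_k=\binom{2k}{k}/(k+1)$. *)

(* Defs.v *)
From mathcomp Require Import all_boot all_order all_algebra.
Set Implicit Arguments. Unset Strict Implicit. Unset Printing Implicit Defensive.
Import Order.TTheory GRing.Theory Num.Theory.
Local Open Scope ring_scope.

(* Catalan number C_k = binom(2k,k)/(k+1) (exact division in nat). *)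
Definition catalan (k : nat) : nat := ('C(k.*2, k) %/ k.+1)%N.

Definition Tgen (n : nat) (b c : int) : int :=
  \sum_(k < n./2.+1) ('C(n, k.*2) * 'C(k.*2, k))%:R * b ^+ (n - k.*2) * c ^+ k.

Definition Mgen (n : nat) (b c : int) : int :=
  \sum_(k < n./2.+1) ('C(n, k.*2) * catalan k)%:R * b ^+ (n - k.*2) * c ^+ k.

(* Main.v *)
(* Put y = c/d. The three-term recurrences of T_n and M_n give linear recurrences
   for the pairs (T_n^2 / d^n, n T_n T_(n-1) / (b d^(n-1))) and
   ((n+1)(n+2) M_n^2 / d^n, n(n+1)(n+2) M_n M_(n-1) / (b d^(n-1))), which are solved
   by polynomials in y:
     n T_n T_(n-1) / (b d^(n-1)) = sum_j (2j+1) binom(2j,j)^2 binom(n+j,2j+1) y^j,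
     (n+1)(n+2) M_n^2 / d^n = sum_j (j+1)(j+2) C_(j+1)^2 binom(n+j+2,2j+2) y^j.
   The powers of d in the statement make the summation over k a hockey-stick
   summation in each coefficient; writing the resulting binomials as multinomials
   exhibits the divisors. The alternating sum telescopes. *)
Require Import Defs.
From mathcomp Require Import all_boot all_order all_algebra.
From mathcomp Require Import ring lra zify.
Import Order.TTheory GRing.Theory Num.Theory.
Local Open Scope ring_scope.

(** * Binomial ratios over a field and shifted sums *)

Lemma natr_binS (F : numFieldType) (n m : nat) :
  ('C(n, m.+1))%:R = (n%:R - m%:R) / m.+1%:R * ('C(n, m))%:R :> F.
Proof.
have [lemn|ltnm] := leqP m n; last by rewrite !bin_small ?mulr0 // ltnW.
apply: (mulfI (x := m.+1%:R)); first by rewrite pnatr_eq0.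
by rewrite mulrA [_ * (_ / _)]mulrC divfK ?pnatr_eq0 // -natrB // -!natrM mul_bin_left.
Qed.

(** With [natr_binS], whose subtraction is taken in the field and so needs no bound on [m], this
    reduces neighbouring binomials to one of them times a rational function, leaving an identity for
    [field]. *)
Lemma natr_binSS (F : numFieldType) (n m : nat) :
  ('C(n.+1, m.+1))%:R = n.+1%:R / m.+1%:R * ('C(n, m))%:R :> F.
Proof.
apply: (mulfI (x := m.+1%:R)); first by rewrite pnatr_eq0.
by rewrite mulrA [_ * (_ / _)]mulrC divfK ?pnatr_eq0 // -!natrM -mul_bin_diag.
Qed.

(** This compares coefficients in a polynomial recurrence: [h] collects the terms multiplied by the
    variable, which land one index higher, and [h N = 0] says that none passes the truncation. *)
Lemma sum_nat_shift (V : zmodType) (f g h : nat -> V) (N : nat) :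
  f 0%N = g 0%N -> (forall j, f j.+1 = g j.+1 + h j) -> h N = 0 ->
  \sum_(0 <= j < N.+1) f j = \sum_(0 <= j < N.+1) (g j + h j).
Proof.
move=> f0 fS hN; rewrite [RHS]big_split /= [X in _ = _ + X]big_nat_recr //= hN addr0.
rewrite [LHS]big_nat_recl // [X in _ = X + _]big_nat_recl // f0 -addrA -big_split /=.
by congr (_ + _); apply: eq_bigr => j _; rewrite fS.
Qed.

(* Replacing every cast by a nonnegative variable leaves a linear goal for [lra]. *)
Ltac natr_neq0 F :=
  rewrite ?andbT; repeat (apply/andP; split);
  repeat match goal with |- context [(?x%:R)%R] => 
     is_var x; let H := fresh in have H := ler0n F x; move: (x%:R)%R H end; intros;
  apply: lt0r_neq0; lra.

(** * Three-term recurrences of the binomial sums *)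

(* [s = 0] gives the trinomial coefficients, [s = 1] the Motzkin numbers. *)
Section Gegenbauer.
Variables (F : realFieldType) (s : nat) (z : F) (w : nat -> F).
Hypothesis w_rec : forall k, (k.+1 + s)%:R * w k.+1 = 2 * (2 * k%:R + 1) * z * w k.

(** After [w k.+1] is replaced through [w_rec], every term is a rational multiple of binom(n, 2k)
    [w k]. *)
Lemma gegenbauer_coef n k :
  (n.+2 + 2 * s)%:R * ('C(n.+2, k.+1.*2)%:R * w k.+1) =
  (2 * n.+1 + 1 + 2 * s)%:R * ('C(n.+1, k.+1.*2)%:R * w k.+1)
  - n.+1%:R * ('C(n, k.+1.*2)%:R * w k.+1) + 4 * n.+1%:R * z * ('C(n, k.*2)%:R * w k).
Proof.
have -> : w k.+1 = (2 * (2 * k%:R + 1) * z * w k) / (k.+1 + s)%:R.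
  by rewrite -w_rec mulrC mulKf // pnatr_eq0.
rewrite doubleS !natr_binSS !natr_binS -mul2n.
field.
natr_neq0 F.
Qed.

Lemma gegenbauer_rec n N : (n < N.*2)%N ->
  let X m := \sum_(0 <= k < N.+1) 'C(m, k.*2)%:R * w k in
  (n.+2 + 2 * s)%:R * X n.+2 =
  (2 * n.+1 + 1 + 2 * s)%:R * X n.+1 - n.+1%:R * (1 - 4 * z) * X n.
Proof.
move=> ltnN X.
pose g k := (2 * n.+1 + 1 + 2 * s)%:R * ('C(n.+1, k.*2)%:R * w k)
  - n.+1%:R * ('C(n, k.*2)%:R * w k).
pose h k := 4 * n.+1%:R * z * ('C(n, k.*2)%:R * w k).
rewrite mulr_sumr (@sum_nat_shift _ _ g h).
- rewrite /g /h /X !mulr_sumr -sumrB; apply: eq_bigr => k _; ring.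
- by rewrite /g !bin0; ring.
- by move=> k; rewrite gegenbauer_coef.
- by rewrite /h bin_small // mul0r mulr0.
Qed.
End Gegenbauer.

(** * Polynomial expansions of squares and consecutive products *)

(* [e = 0] is used for [A m = T_m^2 / d^m] and [e = 1] for the Motzkin squares with
   the index shifted by one, [A m = m (m+1) M_(m-1)^2 / d^(m-1)]. [A 1] is a separate
   hypothesis because [A_rec] would divide by [1 - e]. *)
Section SquareExpansion.
Variables (F : realFieldType) (e y : F) (q A B : nat -> F).
Hypothesis eq0 : e * q 0%N = 0.
Hypothesis q_rec : forall j,
  (j.+1%:R ^+ 2 - e) * q j.+1 = 4 * (2 * j%:R + 1) ^+ 2 * y * q j.
Hypothesis e_lt4 : e < 4.
Hypothesis A0 : A 0%N = q 0%N.
Hypothesis A1 : A 1%N = q 0%N + q 1%N.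
Hypothesis B0 : B 0%N = 0.
Hypothesis B_rec : forall m, B m.+1 = (2 * m%:R + 1) * A m - B m.
Hypothesis A_rec : forall m, (m.+2%:R ^+ 2 - e) * A m.+2 =
  (2 * m%:R + 3) ^+ 2 * (1 + 4 * y) * A m.+1
  - 2 * (2 * m%:R + 3) * (1 + 4 * y) * B m.+1 + (m.+1%:R ^+ 2 - e) * A m.

(** This compares the coefficients at y^(j+1), the powers of y being absorbed in [q]. Writing m as t
    - 1 - j puts all binomials over binom(t, 2j), and [q_rec] turns y q_j into q_(j+1), so a
    rational identity remains. *)
Lemma square_coef (m j t : nat) : t = (m.+1 + j)%N ->
  (m.+2%:R ^+ 2 - e) * (q j.+1 * 'C(t.+2, (2 * j).+2)%:R) =
  (2 * m%:R + 3) ^+ 2 * (q j.+1 * 'C(t.+1, (2 * j).+2)%:R)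
  - 2 * (2 * m%:R + 3) * (q j.+1 * (2 * j.+1%:R + 1) * 'C(t.+1, (2 * j).+3)%:R)
  + (m.+1%:R ^+ 2 - e) * (q j.+1 * 'C(t, (2 * j).+2)%:R)
  + (2 * m%:R + 3) ^+ 2 * (4 * y) * (q j * 'C(t, 2 * j)%:R)
  - 2 * (2 * m%:R + 3) * (4 * y) * (q j * (2 * j%:R + 1) * 'C(t, (2 * j).+1)%:R).
Proof.
move=> tE.
have mE : m%:R = t%:R - 1 - j%:R :> F by rewrite tE; ring.
have yq : 4 * y * q j = (j.+1%:R ^+ 2 - e) * q j.+1 / (2 * j%:R + 1) ^+ 2.
  by rewrite q_rec; field; natr_neq0 F.
rewrite -[m.+2]addn2 -[m.+1]addn1 (natrD _ m 2) (natrD _ m 1) mE.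
have -> (a b : F) : a * (4 * y) * (q j * b) = a * (4 * y * q j) * b by ring.
have -> (a b c : F) : a * (4 * y) * (q j * b * c) = a * (4 * y * q j) * b * c by ring.
rewrite {}yq !natr_binSS !natr_binS.
field.
natr_neq0 F.
Qed.

(** The two expansions are proved together, since each recurrence uses both sequences. [A_rec]
    determines the next [A] because e < 4 keeps (m+2)^2 - e nonzero. *)
Lemma square_expansion (m N : nat) : (m <= N)%N ->
  A m = \sum_(0 <= j < N.+1) q j * 'C(m + j, 2 * j)%:R /\
  B m = \sum_(0 <= j < N.+1) q j * (2 * j%:R + 1) * 'C(m + j, (2 * j).+1)%:R.
Proof.
have BP k : (k < N)%N -> A k = \sum_(0 <= j < N.+1) q j * 'C(k + j, 2 * j)%:R ->
    B k = \sum_(0 <= j < N.+1) q j * (2 * j%:R + 1) * 'C(k + j, (2 * j).+1)%:R ->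
  B k.+1 = \sum_(0 <= j < N.+1) q j * (2 * j%:R + 1) * 'C(k.+1 + j, (2 * j).+1)%:R.
  move=> ltkN Ak Bk; rewrite B_rec Ak Bk mulr_sumr -sumrB; apply: eq_bigr => j _.
  rewrite addSn natr_binSS natr_binS natrD -[(k + j).+1]addn1 !natrD.
  by field; natr_neq0 F.
elim/ltn_ind: m => -[_ _ | [_ N0 | m IH mN]].
- split.
    rewrite big_nat_recl // big1 => [|j _].
      by rewrite A0 bin0 mulr1 addr0.
    by rewrite bin_small ?mulr0 //; lia.
  by rewrite B0 big1 // => j _; rewrite bin_small ?mulr0 //; lia.
- have AN0 : A 0%N = \sum_(0 <= j < N.+1) q j * 'C(0 + j, 2 * j)%:R.
    rewrite big_nat_recl // big1 => [|j _].
      by rewrite A0 bin0 mulr1 addr0.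
    by rewrite bin_small ?mulr0 //; lia.
  split; last first.
    apply: BP => //.
    by rewrite B0 big1 // => j _; rewrite bin_small ?mulr0 //; lia.
  case: N N0 {BP AN0} => // N _.
  rewrite !big_nat_recl // big1 => [|j _].
    by rewrite A1 bin0 binn !mulr1 addr0.
  by rewrite bin_small ?mulr0 //; lia.
have [|A1' B1'] := IH m.+1 (ltnSn _); first exact: ltnW.
have [|Am Bm] := IH m (ltnW (ltnSn _)); first by rewrite ltnW // ltnW.
split; last exact: BP.
have nz : m.+2%:R ^+ 2 - e != 0.
  have := ler0n F m; rewrite -[m.+2]addn2 natrD; move: (m%:R) => M M0.
  by apply: lt0r_neq0; have := sqr_ge0 M; have := e_lt4; lra.
apply: (mulfI nz); rewrite A_rec A1' B1' Am.
pose g j := (2 * m%:R + 3) ^+ 2 * (q j * 'C(m.+1 + j, 2 * j)%:R)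
  - 2 * (2 * m%:R + 3) * (q j * (2 * j%:R + 1) * 'C(m.+1 + j, (2 * j).+1)%:R)
  + (m.+1%:R ^+ 2 - e) * (q j * 'C(m + j, 2 * j)%:R).
pose h j := (2 * m%:R + 3) ^+ 2 * (4 * y) * (q j * 'C(m.+1 + j, 2 * j)%:R)
  - 2 * (2 * m%:R + 3) * (4 * y) * (q j * (2 * j%:R + 1) * 'C(m.+1 + j, (2 * j).+1)%:R).
rewrite [RHS]mulr_sumr [RHS](@sum_nat_shift _ _ g h).
- rewrite /g /h !mulr_sumr -sumrB -big_split /=; apply: eq_bigr => j _; ring.
(* At j = 0 this is (m+2)^2 = (2m+3)^2 - 2(2m+3)(m+1) + (m+1)^2, the terms in e vanishing by
   [eq0]. *)
- rewrite /g !muln0 !bin0 !bin1 !addn0.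
  transitivity ((m.+2%:R ^+ 2) * q 0%N - e * q 0%N); first by ring.
  rewrite eq0 -[m.+2]addn2 -[m.+1]addn1 !natrD.
  transitivity ((2 * m%:R + 3) ^+ 2 * q 0%N
    - 2 * (2 * m%:R + 3) * (q 0%N * (m%:R + 1)) + (m%:R + 1) ^+ 2 * q 0%N - e * q 0%N).
    by rewrite eq0; ring.
  by ring.
- move=> j; rewrite /g /h mulnS !addnS !addSn add0n.
  rewrite (@square_coef m j (m + j).+1); last by rewrite addSn.
  by ring.
- by rewrite /h !bin_small ?mulr0 ?subrr //; lia.
Qed.
End SquareExpansion.

(** * Closed forms for the sums over k *)

Lemma sum_bin_odd (n j : nat) :
  (\sum_(1 <= k < n.+1) 'C(k + j, (2 * j).+1) = 'C((n + j).+1, (2 * j).+2))%N.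
Proof.
elim: n => [|n IH]; first by rewrite big_geq // bin_small //; lia.
by rewrite big_nat_recr //= IH !addSn [RHS]binS addnC.
Qed.

(** The weight k^2 still allows a closed form; in the induction step both sides are multiples of
    binom(n+j+1, 2j+1). *)
Lemma sum_sqr_bin_odd (F : realFieldType) (n j : nat) :
  \sum_(1 <= k < n.+1) k%:R ^+ 2 * 'C(k + j, (2 * j).+1)%:R =
  j.+1%:R / j.+2%:R * (n * n.+1)%:R * 'C((n + j).+1, (2 * j).+2)%:R :> F.
Proof.
elim: n => [|n IH]; first by rewrite big_geq // bin_small ?mulr0 //; lia.
rewrite big_nat_recr //= IH !addSn [in RHS]natr_binSS [in LHS]natr_binS.
move tE: (n + j).+1 => t.
have tF : t%:R = n%:R + 1 + j%:R :> F by rewrite -tE; ring.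
rewrite -[in RHS](addn1 t) (natrD _ t 1) tF.
by field; natr_neq0 F.
Qed.

Lemma sum_odd_bin_even (F : realFieldType) (n j : nat) :
  \sum_(0 <= k < n.+1) (2 * k%:R + 1) * 'C(k + j, 2 * j)%:R =
  (2 * j%:R + 1) / j.+1%:R * n.+1%:R * 'C((n + j).+1, (2 * j).+1)%:R :> F.
Proof.
elim: n => [|n IH].
  rewrite big_nat1 !add0n; case: j => [|j]; first by rewrite bin0 binn; field.
  by rewrite !bin_small ?mulr0 //; lia.
rewrite big_nat_recr //= IH !addSn [in RHS]natr_binSS [in LHS]natr_binS.
move tE: (n + j).+1 => t.
have tF : t%:R = n%:R + 1 + j%:R :> F by rewrite -tE; ring.
rewrite -[in RHS](addn1 t) (natrD _ t 1) tF.
by field; natr_neq0 F.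
Qed.

(** * Catalan numbers and divisors of the coefficients *)

Lemma catalanM (k : nat) : (catalan k * k.+1)%N = 'C(k.*2, k).
Proof.
rewrite /catalan divnK //.
(* k binom(2k, k) = (k+1) binom(2k, k+1), and k+1 is coprime to k. *)
have : (k.+1 %| k * 'C(k.*2, k))%N by rewrite -{2}[k](addnK k) addnn -mul_bin_left dvdn_mulr.
by rewrite Gauss_dvdr // coprimeSn.
Qed.

Lemma central_binS (F : realFieldType) (k : nat) :
  'C(k.+1.*2, k.+1)%:R = 2 * (2 * k%:R + 1) / k.+1%:R * 'C(k.*2, k)%:R :> F.
Proof.
have -> : 'C(k.+1.*2, k.+1) = (2 * 'C(k.*2.+1, k.+1))%N.
  rewrite doubleS binS -(@bin_sub k.*2.+1 k); last by rewrite -addnn; lia.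
  by rewrite (_ : k.*2.+1 - k = k.+1)%N ?mul2n ?addnn //; lia.
by rewrite natrM natr_binSS -mul2n; field; natr_neq0 F.
Qed.

Lemma natr_catalan (F : realFieldType) (k : nat) :
  (catalan k)%:R = 'C(k.*2, k)%:R / k.+1%:R :> F.
Proof. by rewrite -catalanM natrM mulfK // pnatr_eq0. Qed.

Lemma catalanS (F : realFieldType) (k : nat) :
  (catalan k.+1)%:R = 2 * (2 * k%:R + 1) / k.+2%:R * (catalan k)%:R :> F.
Proof. by rewrite !natr_catalan central_binS; field; natr_neq0 F. Qed.

(** Both sides are the multinomial n! / (k! (m-k)! (n-m)!). *)
Lemma bin_trinomial (n m k : nat) : (k <= m <= n)%N ->
  ('C(n, m) * 'C(m, k) = 'C(n, k) * 'C(n - k, m - k))%N.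
Proof.
case/andP=> lekm lemn.
have := fact_gt0 k; have := fact_gt0 (m - k); have := fact_gt0 (n - m).
have := bin_fact lemn; have := bin_fact lekm; have := bin_fact (leq_trans lekm lemn).
have /bin_fact : (m - k <= n - k)%N by lia.
rewrite (_ : n - k - (m - k) = n - m)%N; last by lia.
move=> e1 e2 e3 e4 p1 p2 p3.
apply/eqP; rewrite -(eqn_pmul2r p1) -(eqn_pmul2r p2) -(eqn_pmul2r p3); apply/eqP.
transitivity (n`!).
  by rewrite -e4 -e3; ring.
by rewrite -e2 -e1; ring.
Qed.

(** Splitting binom(n+j+2, 2j+2) binom(2j+2, j) as binom(n+j+2, j) binom(n+2, j+2) brings out
    (n+1)(n+2) from the last factor; the remaining central binomial over j+1 is C_j. *)
Lemma sum_T_coef (F : realFieldType) (n j : nat) : (j <= n)%N ->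
  (2 * j%:R + 1) * 'C(j.*2, j)%:R ^+ 2 * 'C((n.+1 + j).+1, (2 * j).+2)%:R =
  (n.+1 * n.+2)%:R / 2 * (catalan j * 'C(n, j) * 'C((n.+1 + j).+1, j))%:R :> F.
Proof.
move=> lejn.
have /(congr1 (fun x => x%:R : F)) := @bin_trinomial (n.+1 + j).+1 (2 * j).+2 j ltac:(lia).
rewrite (_ : (n.+1 + j).+1 - j = n.+2)%N; last by lia.
rewrite (_ : (2 * j).+2 - j = j.+2)%N; last by lia.
rewrite !natrM natr_catalan.
(* binom(2j+2, j) is obtained from its central neighbour binom(2j+2, j+1). *)
have -> : 'C((2 * j).+2, j)%:R = 2 * (2 * j%:R + 1) / j.+2%:R * 'C(j.*2, j)%:R :> F.
  have := central_binS F j; rewrite natr_binS doubleS -mul2n.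
  move: ('C((2 * j).+2, j)%:R) ('C(2 * j, j)%:R) => u v uv.
  have -> : u = ((2 * j).+2%:R - j%:R) / j.+1%:R * u * (j.+1%:R / j.+2%:R).
    by field; natr_neq0 F.
  by rewrite uv; field; natr_neq0 F.
have : 'C(j.*2, j)%:R != 0 :> F by rewrite pnatr_eq0 -lt0n bin_gt0; lia.
rewrite (natr_binSS F n.+1) (natr_binSS F n).
move: ('C(j.*2, j)%:R) ('C((n.+1 + j).+1, (2 * j).+2)%:R) => u v.
move: ('C((n.+1 + j).+1, j)%:R) ('C(n, j)%:R) => p r u0 E.
have -> : v = v * (2 * (2 * j%:R + 1) / j.+2%:R * u) / u * (j.+2%:R / (2 * (2 * j%:R + 1))).
  by field; rewrite u0 /=; natr_neq0 F.
by rewrite E; field; rewrite u0 /=; natr_neq0 F.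
Qed.

Lemma catalan_bin (j : nat) : (catalan j.+1 * (2 * j).+3)%N = 'C((2 * j).+3, j.+2).
Proof.
apply/eqP; rewrite -(eqr_nat rat); apply/eqP.
by rewrite natrM natr_catalan (natr_binSS _ (2 * j).+2) doubleS -mul2n; field; natr_neq0 rat.
Qed.

Lemma catalan_bin_sym (j : nat) : (catalan j.+1 * (2 * j).+3)%N = 'C((2 * j).+3, j.+1).
Proof.
rewrite catalan_bin -bin_sub; last by lia.
by congr ('C(_, _)); lia.
Qed.

(** Since (2j+3) C_(j+1) = binom(2j+3, j+2), its product with binom(n+j+3, 2j+3) splits as
    binom(n+j+3, j+2) binom(n+1, j+1), and (j+1) binom(n+1, j+1) = (n+1) binom(n, j) brings out
    n+1. *)
Lemma sum_M_coef (n j : nat) : (j <= n)%N ->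
  (j.+1 * (2 * j).+3 * n.+2 * catalan j.+1 ^ 2 * 'C((n.+1 + j).+2, (2 * j).+3) =
   n.+1 * n.+2 * (catalan j.+1 * 'C(n, j) * 'C((n.+1 + j).+2, j.+2)))%N.
Proof.
move=> lejn.
have := @bin_trinomial (n.+1 + j).+2 (2 * j).+3 j.+2 ltac:(lia).
rewrite (_ : (n.+1 + j).+2 - j.+2 = n.+1)%N; last by lia.
rewrite (_ : (2 * j).+3 - j.+2 = j.+1)%N; last by lia.
rewrite -catalan_bin => E.
transitivity (j.+1 * n.+2 * catalan j.+1 *
  ('C((n.+1 + j).+2, (2 * j).+3) * (catalan j.+1 * (2 * j).+3)))%N; first by ring.
rewrite E.
transitivity (n.+2 * catalan j.+1 * 'C((n.+1 + j).+2, j.+2) * (j.+1 * 'C(n.+1, j.+1)))%N.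
  by ring.
by rewrite -mul_bin_diag; ring.
Qed.

(** The other choice binom(2j+3, j+1) gives the cofactors binom(n+j+3, j+1) and binom(n+2, j+2), and
    (j+1) binom(n+j+3, j+1) = (n+3) binom(n+j+3, j) brings out n+3. *)
Lemma sum_M_coef_sym (n j : nat) : (j <= n)%N ->
  (j.+1 * (2 * j).+3 * n.+2 * catalan j.+1 ^ 2 * 'C((n.+1 + j).+2, (2 * j).+3) =
   n.+2 * n.+3 * (catalan j.+1 * 'C(n.+2, j.+2) * 'C((n.+1 + j).+2, j)))%N.
Proof.
move=> lejn.
have := @bin_trinomial (n.+1 + j).+2 (2 * j).+3 j.+1 ltac:(lia).
rewrite (_ : (n.+1 + j).+2 - j.+1 = n.+2)%N; last by lia.
rewrite (_ : (2 * j).+3 - j.+1 = j.+2)%N; last by lia.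
rewrite -catalan_bin_sym => E.
transitivity (j.+1 * n.+2 * catalan j.+1 *
  ('C((n.+1 + j).+2, (2 * j).+3) * (catalan j.+1 * (2 * j).+3)))%N; first by ring.
rewrite E.
transitivity (n.+2 * catalan j.+1 * 'C(n.+2, j.+2) * (j.+1 * 'C((n.+1 + j).+2, j.+1)))%N.
  by ring.
rewrite mul_bin_left (_ : (n.+1 + j).+2 - j = n.+3)%N; last by lia.
by ring.
Qed.

(** * The common integer form of both families and its recurrence *)

Definition gegenbauer_sum (w : nat -> nat) (n : nat) (b c : int) : int :=
  \sum_(k < n./2.+1) ('C(n, k.*2) * w k)%:R * b ^+ (n - k.*2) * c ^+ k.

(** Terms with 2k > n vanish, so the bound N is free above n and three consecutive indices can share
    it. *)
Lemma gegenbauer_sumE (w : nat -> nat) (n N : nat) (b c : int) :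
  b != 0 -> (n <= N)%N ->
  (gegenbauer_sum w n b c)%:~R = b%:~R ^+ n *
    \sum_(0 <= k < N.+1) 'C(n, k.*2)%:R * ((w k)%:R * (c%:~R / b%:~R ^+ 2) ^+ k) :> rat.
Proof.
move=> b0 leN.
have b0' : b%:~R != 0 :> rat by rewrite intr_eq0.
rewrite mulr_sumr [RHS](big_cat_nat (n := n./2.+1)) //=; last by lia.
rewrite [X in _ = _ + X]big_nat_cond [X in _ = _ + X]big1 ?addr0 => [|k]; last first.
  by case/andP => /andP[lek _] _; rewrite bin_small ?mul0r ?mulr0 //; lia.
rewrite /gegenbauer_sum -(big_mkord xpredT
  (fun k => ('C(n, k.*2) * w k)%:R * b ^+ (n - k.*2) * c ^+ k)) raddf_sum.
apply: eq_big_nat => k /andP[_ lek] /=.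
have {3}-> : n = ((n - k.*2) + k.*2)%N by lia.
rewrite exprD -mul2n exprM expr_div_n natrM !rmorphM /= !rmorphXn /= !rmorph_nat.
have : b%:~R ^+ 2 ^+ k != 0 :> rat by rewrite !expf_neq0.
by move: (b%:~R ^+ 2 ^+ k : rat) => B B0; field.
Qed.

Lemma gegenbauer_sum_rec (s : nat) (w : nat -> nat) (n : nat) (b c : int) :
  (forall k, (k.+1 + s) * w k.+1 = 2 * (2 * k + 1) * w k)%N -> b != 0 ->
  (n.+2 + 2 * s)%:R * gegenbauer_sum w n.+2 b c =
  (2 * n.+1 + 1 + 2 * s)%:R * b * gegenbauer_sum w n.+1 b c
  - n.+1%:R * (b ^+ 2 - 4 * c) * gegenbauer_sum w n b c.
Proof.
move=> w_rec b0; apply: (@intr_inj rat).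
have b0' : b%:~R != 0 :> rat by rewrite intr_eq0.
rewrite !(rmorphM, rmorphB, rmorphXn) /= !rmorph_nat.
rewrite !(@gegenbauer_sumE w _ n.+2) //; last by lia.
have := @gegenbauer_rec rat s (c%:~R / b%:~R ^+ 2)
  (fun k => (w k)%:R * (c%:~R / b%:~R ^+ 2) ^+ k).
have w_rec' k : (k.+1 + s)%:R * ((w k.+1)%:R * (c%:~R / b%:~R ^+ 2) ^+ k.+1) =
   2 * (2 * k%:R + 1) * (c%:~R / b%:~R ^+ 2) * ((w k)%:R * (c%:~R / b%:~R ^+ 2) ^+ k) :> rat.
  by rewrite mulrA -natrM w_rec exprS; ring.
move=> /(_ w_rec' n n.+2 ltac:(lia)) /=.
set S2 := \sum_(_ <= _ < _) _; set S1 := \sum_(_ <= _ < _) _; set S0 := \sum_(_ <= _ < _) _.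
move=> E; rewrite mulrCA E !exprS.
by field.
Qed.

(** * Sums of products of trinomial coefficients *)

Section TrinomialSums.
Variables (F : realFieldType) (b c d : F) (T : nat -> F).
Hypotheses (b0 : b != 0) (d0 : d != 0) (dE : d = b ^+ 2 - 4 * c).
Hypotheses (T0 : T 0%N = 1) (T1 : T 1%N = b).
Hypothesis T_rec : forall n,
  n.+2%:R * T n.+2 = (2 * n%:R + 3) * b * T n.+1 - n.+1%:R * d * T n.

(** Multiplying [T_rec] by T_(n+1) gives [B_rec] and squaring it gives [A_rec], with b^2/d = 1 + 4y.
    The quotient d^m / d replaces d^(m-1), so that m = 0 is included. *)
Lemma T_mul_expansion (m N : nat) : (m <= N)%N ->
  m%:R * T m * T m.-1 = b * d ^+ m / d * \sum_(0 <= j < N.+1)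
    'C(j.*2, j)%:R ^+ 2 * (c / d) ^+ j * (2 * j%:R + 1) * 'C(m + j, (2 * j).+1)%:R.
Proof.
move=> leN.
pose q j := 'C(j.*2, j)%:R ^+ 2 * (c / d) ^+ j.
pose A m := T m ^+ 2 / d ^+ m.
pose B m := m%:R * T m * T m.-1 * d / (b * d ^+ m).
have dX k : d ^+ k != 0 by rewrite expf_neq0.
have c_d : c / d = (b ^+ 2 / d - 1) / 4.
  by have -> : c = (b ^+ 2 - d) / 4 by [rewrite dE; field]; field.
have T_rec' n : T n.+2 = ((2 * n%:R + 3) * b * T n.+1 - n.+1%:R * d * T n) / n.+2%:R.
  by rewrite -T_rec mulrC mulKf // pnatr_eq0.
have [] := @square_expansion F 0 (c / d) q A B _ _ _ _ _ _ _ _ m N leN.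
- by rewrite mul0r.
- move=> j; rewrite /q central_binS subr0 (exprS _ j); move: ((c / d) ^+ j) (c / d) => Z z.
  by field; natr_neq0 F.
- by rewrite ltr0n.
- by rewrite /A /q T0 bin0 !expr0 !expr1n mulr1 divr1.
- by rewrite /A /q T1 bin0 !expr0 c_d (_ : 'C(1.*2, 1) = 2%N) //; field.
- by rewrite /B !mul0r.
- case=> [|n]; first by rewrite /B /A T0 T1; field; rewrite b0 d0.
  rewrite /A /B T_rec' !exprS /=; have := dX n; move: (d ^+ n) => D D0.
  by field; rewrite b0 d0 D0 /=; natr_neq0 F.
- move=> n; rewrite c_d /A /B T_rec' !exprS /=; have := dX n; move: (d ^+ n) => D D0.
  by field; rewrite b0 d0 D0 /=; natr_neq0 F.
move=> _ <-; rewrite /B; have := dX m; move: (d ^+ m) => D D0.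
by field; rewrite b0 d0 D0.
Qed.

(** By [T_mul_expansion] the powers of d combine to d^n for every k, so after exchanging the sums
    the inner one contains only [f] and a binomial. *)
Lemma sum_T_mul (f : nat -> F) (n : nat) :
  \sum_(1 <= k < n.+2) f k * (k%:R * T k * T k.-1) * d ^+ (n.+1 - k) =
  b * \sum_(0 <= j < n.+1) (2 * j%:R + 1) * 'C(j.*2, j)%:R ^+ 2 *
    (\sum_(1 <= k < n.+2) f k * 'C(k + j, (2 * j).+1)%:R) * (c ^+ j * d ^+ (n - j)).
Proof.
pose t k j := b * d ^+ n * (f k * ('C(j.*2, j)%:R ^+ 2 * (c / d) ^+ j *
  (2 * j%:R + 1) * 'C(k + j, (2 * j).+1)%:R)).
transitivity (\sum_(1 <= k < n.+2) \sum_(0 <= j < n.+2) t k j).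
  apply: eq_big_nat => k /andP[_ lek].
  rewrite (@T_mul_expansion k n.+1) // /t -!mulr_sumr.
  have -> : d ^+ n = d ^+ k * d ^+ (n.+1 - k) / d.
    by rewrite -exprD subnKC // exprS mulrC mulKf.
  by field.
(* The term j = n+1 drops out: k <= n+1 gives k+n+1 < 2(n+1)+1. *)
rewrite exchange_big big_nat_recr //= [X in _ + X]big_nat_cond [X in _ + X]big1 => [|k]; last first.
  by case/andP=> /andP[_ lek] _; rewrite /t (@bin_small (k + n.+1)) ?mulr0 //; lia.
rewrite addr0 mulr_sumr; apply: eq_big_nat => j /andP[_ lej].
rewrite /t -!mulr_sumr.
transitivity (b * d ^+ n * (('C(j.*2, j)%:R ^+ 2 * (c / d) ^+ j * (2 * j%:R + 1)) *
    \sum_(1 <= k < n.+2) f k * 'C(k + j, (2 * j).+1)%:R)).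
  by congr (_ * _); rewrite mulr_sumr; apply: eq_bigr => k _; ring.
have -> : d ^+ n = d ^+ (n - j) * d ^+ j by rewrite -exprD subnK.
rewrite expr_div_n; have : d ^+ j != 0 by rewrite expf_neq0.
by move: (d ^+ j) => D D0; field.
Qed.

Lemma sum_T (n : nat) :
  \sum_(1 <= k < n.+2) k%:R * T k * T k.-1 * d ^+ (n.+1 - k) =
  b * ((n.+1 * n.+2)%:R / 2) * \sum_(0 <= j < n.+1)
    (catalan j * 'C(n, j) * 'C((n.+1 + j).+1, j))%:R * (c ^+ j * d ^+ (n - j)).
Proof.
transitivity (\sum_(1 <= k < n.+2) 1 * (k%:R * T k * T k.-1) * d ^+ (n.+1 - k)).
  by apply: eq_bigr => k _; rewrite mul1r.
rewrite (sum_T_mul (fun=> 1)) -[RHS]mulrA [in RHS]mulr_sumr; congr (_ * _).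
apply: eq_big_nat => j /andP[_ lej].
rewrite [RHS]mulrA -sum_T_coef // -sum_bin_odd natr_sum.
by congr (_ * _ * _); apply: eq_bigr => k _; rewrite mul1r.
Qed.

(* The integer [4 binom(2j,j) - (j+1) C_(j+1)] is [6 binom(2j,j) / (j+2)]; the factor
   3 of the theorem is what makes it an integer. *)
Lemma sum_cube_T (n : nat) :
  3 * \sum_(1 <= k < n.+2) k%:R ^+ 3 * T k * T k.-1 * d ^+ (n.+1 - k) =
  b * ((n.+1 * n.+2)%:R / 2) ^+ 2 * \sum_(0 <= j < n.+1)
    ((4 * 'C(j.*2, j)%:R - (j.+1 * catalan j.+1)%:R) * ('C(n, j) * 'C((n.+1 + j).+1, j))%:R)
    * (c ^+ j * d ^+ (n - j)).
Proof.
transitivity (3 * \sum_(1 <= k < n.+2) k%:R ^+ 2 * (k%:R * T k * T k.-1) * d ^+ (n.+1 - k)).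
  by congr (_ * _); apply: eq_bigr => k _; ring.
rewrite (sum_T_mul (fun k => k%:R ^+ 2)) mulrCA -[RHS]mulrA; congr (_ * _); rewrite !mulr_sumr.
apply: eq_big_nat => j /andP[_ lej].
have := @sum_T_coef F n j lej.
rewrite sum_sqr_bin_odd !natrM catalanS natr_catalan.
move: ('C((n.+1 + j).+1, (2 * j).+2)%:R) => u uE.
transitivity (3 * (j.+1%:R / j.+2%:R * (n.+1%:R * n.+2%:R) *
    ((2 * j%:R + 1) * 'C(j.*2, j)%:R ^+ 2 * u)) * (c ^+ j * d ^+ (n - j))).
  by ring.
by rewrite uE; field; natr_neq0 F.
Qed.
End TrinomialSums.

(** * Sums of squares of Motzkin numbers *)

Section MotzkinSums.
Variables (F : realFieldType) (b c d : F) (M : nat -> F).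
Hypotheses (b0 : b != 0) (d0 : d != 0) (dE : d = b ^+ 2 - 4 * c).
Hypotheses (M0 : M 0%N = 1) (M1 : M 1%N = b).
Hypothesis M_rec : forall n,
  n.+4%:R * M n.+2 = (2 * n%:R + 5) * b * M n.+1 - n.+1%:R * d * M n.

Lemma M_sqr_expansion (m N : nat) : (m <= N)%N ->
  (m.+1 * m.+2)%:R * M m ^+ 2 = d ^+ m * \sum_(0 <= j < N.+1)
    (j.+1 * j.+2 * catalan j.+1 ^ 2)%:R * (c / d) ^+ j * 'C(m.+1 + j.+1, 2 * j.+1)%:R.
Proof.
move=> leN.
(* The index shift makes [q 0] zero, as [eq0] requires for e = 1. Where predecessors truncate in [A]
   and [B], a numeric factor is zero. *)
pose q j := if j is i.+1 then (i.+1 * i.+2 * catalan i.+1 ^ 2)%:R * (c / d) ^+ i else 0.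
pose A m := (m * m.+1)%:R * M m.-1 ^+ 2 * d / d ^+ m.
pose B m := (m.-1 * m * m.+1)%:R * M m.-1 * M m.-2 * d ^+ 2 / (b * d ^+ m).
have dX k : d ^+ k != 0 by rewrite expf_neq0.
have c_d : c / d = (b ^+ 2 / d - 1) / 4.
  by have -> : c = (b ^+ 2 - d) / 4 by [rewrite dE; field]; field.
have M_rec' n : M n.+2 = ((2 * n%:R + 5) * b * M n.+1 - n.+1%:R * d * M n) / n.+4%:R.
  by rewrite -M_rec mulrC mulKf // pnatr_eq0.
have [] := @square_expansion F 1 (c / d) q A B _ _ _ _ _ _ _ _ m.+1 N.+1 leN.
- by rewrite mulr0.
- case=> [|j]; first by rewrite [q 0]/= mulr0; ring.
  rewrite /q (exprS _ j) !natrM catalanS.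
  move: ((c / d) ^+ j) (c / d) => Z z.
  by field; natr_neq0 F.
- by rewrite ltr1n.
- by rewrite /A !mul0r.
- by rewrite /A /q M0 expr0 expr1 (_ : catalan 1 = 1%N) //; field.
- by rewrite /B !mul0r.
(* Small indices are treated apart, because [M_rec] first reaches M_2, which enters at [B 3]. *)
- case=> [|[|n]].
  + by rewrite /B /A !mul0r mulr0 subrr.
  + by rewrite /B /A /= M0 M1; field; rewrite b0 d0.
  rewrite /A /B /= M_rec' !exprS !natrM; have := dX n; move: (d ^+ n) => D D0.
  by field; rewrite b0 d0 D0 /=; natr_neq0 F.
- case=> [|n]; first by rewrite c_d /A /B /= M0 M1; field; rewrite b0 d0.
  rewrite c_d /A /B /= M_rec' !exprS !natrM; have := dX n; move: (d ^+ n) => D D0.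
  by field; rewrite b0 d0 D0 /=; natr_neq0 F.
rewrite big_nat_recl // mul0r add0r -/q => AE _.
rewrite -AE /A /= (exprS d m); have := dX m; move: (d ^+ m) => D D0.
by field; rewrite d0 D0.
Qed.

(* [sum_M_coef] and [sum_M_coef_sym] show that each coefficient is divisible by
   [(n+1)(n+2)] and by [(n+2)(n+3)]. *)
Lemma sum_M (n : nat) :
  \sum_(0 <= k < n.+1) (k.+1 * k.+2 * (2 * k + 3))%:R * M k ^+ 2 * d ^+ (n - k) =
  \sum_(0 <= j < n.+1)
    (j.+1 * (2 * j).+3 * n.+2 * catalan j.+1 ^ 2 * 'C((n.+1 + j).+2, (2 * j).+3))%:R
    * (c ^+ j * d ^+ (n - j)).
Proof.
pose t k j := d ^+ n * ((2 * k.+1%:R + 1) * ((j.+1 * j.+2 * catalan j.+1 ^ 2)%:R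
  * (c / d) ^+ j * 'C(k.+1 + j.+1, 2 * j.+1)%:R)).
transitivity (\sum_(0 <= k < n.+1) \sum_(0 <= j < n.+1) t k j).
  apply: eq_big_nat => k /andP[_ lek].
  rewrite /t -!mulr_sumr.
  have -> : d ^+ n = d ^+ k * d ^+ (n - k) by rewrite -exprD subnKC.
  have := @M_sqr_expansion k n lek; set S := \sum_(_ <= _ < _) _ => E.
  transitivity ((2 * k.+1%:R + 1) * d ^+ (n - k) * (d ^+ k * S)); last by ring.
  by rewrite -E; ring.
rewrite exchange_big; apply: eq_big_nat => j /andP[_ lej].
rewrite /t -!mulr_sumr.
(* Since 2k+3 = 2(k+1)+1, the sum is reindexed by k+1; the added first term has binom(j+1, 2j+2) =
   0. *)
transitivity (d ^+ n * (((j.+1 * j.+2 * catalan j.+1 ^ 2)%:R * (c / d) ^+ j) *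
    \sum_(0 <= k < n.+2) (2 * k%:R + 1) * 'C(k + j.+1, 2 * j.+1)%:R)).
  rewrite [in RHS]big_nat_recl // [in RHS]bin_small ?mulr0 ?add0r; last by lia.
  by congr (_ * _); rewrite mulr_sumr; apply: eq_bigr => k _; ring.
rewrite sum_odd_bin_even.
have -> : d ^+ n = d ^+ (n - j) * d ^+ j by rewrite -exprD subnK.
rewrite expr_div_n; have : d ^+ j != 0 by rewrite expf_neq0.
rewrite !addnS !addSn (mulnS 2 j) add2n !natrM.
by move: (d ^+ j) => D D0; field; rewrite D0 /=; natr_neq0 F.
Qed.

(** Raising n multiplies the sum by -d and adds one square; apart from the common factor (n+2)(n+3)
    M_(n+1), the step is exactly [M_rec]. *)
Lemma sum_M_alternating (n : nat) :
  b * \sum_(0 <= k < n.+1) (k.+1 * k.+2 * (2 * k + 3))%:R * M k ^+ 2 * (- d) ^+ (n - k) =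
  (n.+1 * n.+2 * n.+3)%:R * (M n.+1 * M n).
Proof.
elim: n => [|n IH]; first by rewrite big_nat1 expr0 M0 M1; ring.
rewrite big_nat_recr //= subnn expr0 mulr1 mulrDr.
have -> : \sum_(0 <= k < n.+1) (k.+1 * k.+2 * (2 * k + 3))%:R * M k ^+ 2 * (- d) ^+ (n.+1 - k)
  = - d * \sum_(0 <= k < n.+1) (k.+1 * k.+2 * (2 * k + 3))%:R * M k ^+ 2 * (- d) ^+ (n - k).
  rewrite mulr_sumr; apply: eq_big_nat => k /andP[_ lek].
  by rewrite subSn // (exprS (- d)); ring.
rewrite mulrCA IH.
transitivity ((n.+2 * n.+3)%:R * M n.+1 * (n.+4%:R * M n.+2)); last by ring.
by rewrite M_rec; ring.
Qed.
End MotzkinSums.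

(** * Recurrences of T_n and M_n, and integer divisibility *)

Lemma half_mulSn (F : realFieldType) (n : nat) :
  ((n * n.+1) %/ 2)%N%:R = (n * n.+1)%:R / 2 :> F.
Proof.
have {2}<- : ((n * n.+1) %/ 2 * 2)%N = (n * n.+1)%N by apply: divnK; rewrite dvdn2 oddM /= andbN.
by rewrite natrM mulfK // pnatr_eq0.
Qed.

Lemma quarter_sqr_mulSn (n : nat) :
  ((n ^ 2 * n.+1 ^ 2) %/ 4 = ((n * n.+1) %/ 2) ^ 2)%N.
Proof.
have : ((n * n.+1) %/ 2 * 2)%N = (n * n.+1)%N by apply: divnK; rewrite dvdn2 oddM /= andbN.
by move: (_ %/ 2)%N => t; rewrite -expnMn => <-; rewrite expnMn mulnK.
Qed.

Lemma Tgen_rec (b c : int) (n : nat) : b != 0 ->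
  n.+2%:R * Tgen n.+2 b c =
  (2 * n%:R + 3) * b * Tgen n.+1 b c - n.+1%:R * (b ^+ 2 - 4 * c) * Tgen n b c.
Proof.
move=> b0.
have w_rec k : ((k.+1 + 0) * 'C(k.+1.*2, k.+1) = 2 * (2 * k + 1) * 'C(k.*2, k))%N.
  apply/eqP; rewrite -(eqr_nat rat); apply/eqP.
  by rewrite natrM central_binS; field; natr_neq0 rat.
(* [Tgen] is convertible with [gegenbauer_sum] at the central binomials, so the general recurrence
   has this type. *)
have : (n.+2 + 2 * 0)%:R * Tgen n.+2 b c = (2 * n.+1 + 1 + 2 * 0)%:R * b * Tgen n.+1 b c
  - n.+1%:R * (b ^+ 2 - 4 * c) * Tgen n b c := gegenbauer_sum_rec _ _ n _ _ w_rec b0.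
by rewrite muln0 !addn0 => ->; ring.
Qed.

Lemma Mgen_rec (b c : int) (n : nat) : b != 0 ->
  n.+4%:R * Mgen n.+2 b c =
  (2 * n%:R + 5) * b * Mgen n.+1 b c - n.+1%:R * (b ^+ 2 - 4 * c) * Mgen n b c.
Proof.
move=> b0.
have w_rec k : ((k.+1 + 1) * catalan k.+1 = 2 * (2 * k + 1) * catalan k)%N.
  apply/eqP; rewrite -(eqr_nat rat); apply/eqP.
  by rewrite natrM catalanS; field; natr_neq0 rat.
have : (n.+2 + 2 * 1)%:R * Mgen n.+2 b c = (2 * n.+1 + 1 + 2 * 1)%:R * b * Mgen n.+1 b c
  - n.+1%:R * (b ^+ 2 - 4 * c) * Mgen n b c := gegenbauer_sum_rec _ _ n _ _ w_rec b0.
by rewrite (_ : (n.+2 + 2 * 1)%N = n.+4) ?addn2 // => ->; ring.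
Qed.

(** For odd n every exponent n - 2k is positive. *)
Lemma dvdz_Mgen (b c : int) (n : nat) : odd n -> (b %| Mgen n b c)%Z.
Proof.
move=> n_odd; apply: rpred_sum => k _.
rewrite dvdz_mulr // dvdz_mull // dvdz_exp //.
have := ltn_ord k; have := odd_double_half n; rewrite n_odd; lia.
Qed.

Lemma dvdz_Mgen_mul (b c : int) (n : nat) : (b %| Mgen n.+1 b c * Mgen n b c)%Z.
Proof.
have [n_odd|n_even] := boolP (odd n); first by rewrite dvdz_mull // dvdz_Mgen.
by rewrite dvdz_mulr // dvdz_Mgen.
Qed.

(* [n+3] divides both [(n+1) x1] and [(n+3) x1], and [gcd (n+1) (n+3) = gcd 2 (n+1)]. *)
Lemma gcd2_divides (n : nat) (x1 x2 : int) :
  n.+1%:R * x1 = n.+3%:R * x2 -> exists z : int, (gcdn 2 n.+1)%:R * x1 = n.+3%:R * z.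
Proof.
move=> E; have [/= n_odd|n_even] := boolP (odd n).
  exists (x1 - x2); rewrite mulrBr -E (_ : gcdn 2 n.+1 = 2); first by ring.
  by apply/gcdn_idPl; rewrite dvdn2 /= n_odd.
have nE : n = (2 * n./2)%N by rewrite mul2n -{1}(odd_double_half n) (negbTE n_even).
(* With n = 2m, the coefficients satisfy (m+1)(2m+1) - m(2m+3) = 1. *)
exists (n./2.+1%:R * x2 - n./2%:R * x1).
rewrite (_ : gcdn 2 n.+1 = 1%N); last first.
  by apply/eqP; rewrite -/(coprime 2 n.+1) coprime2n /= n_even.
rewrite mulrBr mulrCA -E; move: (n./2) nE => m ->; ring.
Qed.

(** * Transfer to the rationals and the four assertions *)

Theorem theorem1p3 (b c : int) (n : nat) :
  b != 0 -> b ^+ 2 - 4 * c != 0 -> (0 < n)%N ->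
  let d := b ^+ 2 - 4 * c in
  [/\ (b * ((n * n.+1) %/ 2)%N%:Z %|
         \sum_(1 <= k < n.+1) k%:Z * Tgen k b c * Tgen k.-1 b c * d ^+ (n - k))%Z,
      (b * ((n ^ 2 * n.+1 ^ 2) %/ 4)%N%:Z %|
         3 * \sum_(1 <= k < n.+1) (k ^ 3)%N%:Z * Tgen k b c * Tgen k.-1 b c * d ^+ (n - k))%Z,
      exists z : int,
        (gcdn 2 n)%:R / (n * n.+1 * n.+2)%N%:R *
          \sum_(0 <= k < n) ((k.+1 * k.+2 * (2 * k + 3))%N%:R * (Mgen k b c ^+ 2)%:~R
                             * (d ^+ (n.-1 - k))%:~R) = z%:~R :> rat
    & \sum_(0 <= k < n) ((k.+1 * k.+2 * (2 * k + 3))%N%:R / (n * n.+1 * n.+2)%N%:R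
                         * (Mgen k b c ^+ 2)%:~R * ((- d) ^+ (n.-1 - k))%:~R)
        = (Mgen n b c * Mgen n.-1 b c)%:~R / b%:~R :> rat
      /\ exists z : int, (Mgen n b c * Mgen n.-1 b c)%:~R / b%:~R = z%:~R :> rat].
Proof.
case: n => // n b0 d0 _ d; rewrite -/d in d0; rewrite [n.+1.-1]/=.
pose toQ (x : int) : rat := x%:~R.
have b0' : toQ b != 0 by rewrite intr_eq0.
have d0' : toQ d != 0 by rewrite intr_eq0.
have dE : toQ d = toQ b ^+ 2 - 4 * toQ c by rewrite /toQ /d; ring.
have T0 : toQ (Tgen 0 b c) = 1 by rewrite /Tgen big_ord1.
have T1 : toQ (Tgen 1 b c) = toQ b by rewrite /Tgen big_ord1 bin0 mul1r expr1 mulr1.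
have T_rec k : k.+2%:R * toQ (Tgen k.+2 b c) =
    (2 * k%:R + 3) * toQ b * toQ (Tgen k.+1 b c) - k.+1%:R * toQ d * toQ (Tgen k b c).
  transitivity (toQ (k.+2%:R * Tgen k.+2 b c)); first by rewrite /toQ; ring.
  by rewrite Tgen_rec // dE /toQ; ring.
have M0 : toQ (Mgen 0 b c) = 1 by rewrite /Mgen big_ord1.
have M1 : toQ (Mgen 1 b c) = toQ b by rewrite /Mgen big_ord1 bin0 mul1r expr1 mulr1.
have M_rec k : k.+4%:R * toQ (Mgen k.+2 b c) =
    (2 * k%:R + 5) * toQ b * toQ (Mgen k.+1 b c) - k.+1%:R * toQ d * toQ (Mgen k b c).
  transitivity (toQ (k.+4%:R * Mgen k.+2 b c)); first by rewrite /toQ; ring.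
  by rewrite Mgen_rec // dE /toQ; ring.
have toQ_cd j : toQ c ^+ j * toQ d ^+ (n - j) = toQ (c ^+ j * d ^+ (n - j)).
  by rewrite /toQ rmorphM !rmorphXn.
have toQM x y : toQ (x * y) = toQ x * toQ y by rewrite /toQ rmorphM.
have toQX x m : toQ (x ^+ m) = toQ x ^+ m by rewrite /toQ rmorphXn.
have toQ_nat m : toQ m%:Z = m%:R by [].
have toQ_sum m p (f : nat -> int) :
    toQ (\sum_(m <= k < p) f k) = \sum_(m <= k < p) toQ (f k) by rewrite /toQ rmorph_sum.
have half : toQ ((n.+1 * n.+2) %/ 2)%N%:Z = (n.+1 * n.+2)%:R / 2.
  by rewrite -half_mulSn.
split.
(* The quotient is the integer sum on the right of [sum_T]. *)
- apply/dvdzP; exists (\sum_(0 <= j < n.+1)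
    (catalan j * 'C(n, j) * 'C((n.+1 + j).+1, j))%:R * (c ^+ j * d ^+ (n - j))).
  apply: (@intr_inj rat); rewrite -/(toQ _) -[RHS]/(toQ _) !toQM half toQ_sum.
  transitivity (\sum_(1 <= k < n.+2) k%:R * toQ (Tgen k b c) * toQ (Tgen k.-1 b c)
    * toQ d ^+ (n.+1 - k)).
    by apply: eq_bigr => k _; rewrite !toQM toQX.
  rewrite (@sum_T _ _ _ _ _ b0' d0' dE T0 T1 T_rec) [RHS]mulrC toQ_sum; congr (_ * _).
  by apply: eq_bigr => j _; rewrite toQ_cd /toQ; ring.
- apply/dvdzP; exists (\sum_(0 <= j < n.+1)
    ((4 * 'C(j.*2, j)%:R - (j.+1 * catalan j.+1)%:R) * ('C(n, j) * 'C((n.+1 + j).+1, j))%:R)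
    * (c ^+ j * d ^+ (n - j))).
  apply: (@intr_inj rat); rewrite quarter_sqr_mulSn PoszM.
  rewrite -/(toQ _) -[RHS]/(toQ _) !toQM half toQ_sum.
  transitivity (3 * \sum_(1 <= k < n.+2) k%:R ^+ 3 * toQ (Tgen k b c) * toQ (Tgen k.-1 b c)
    * toQ d ^+ (n.+1 - k)).
    by congr (_ * _); apply: eq_bigr => k _; rewrite !toQM toQX toQ_nat natrX.
  rewrite (@sum_cube_T _ _ _ _ _ b0' d0' dE T0 T1 T_rec) [RHS]mulrC toQ_sum; congr (_ * _).
  by apply: eq_bigr => j _; rewrite toQ_cd /toQ; ring.
- set S := \sum_(0 <= k < n.+1) _.
  (* S equals both (n+1)(n+2) [x1] and (n+2)(n+3) [x2]; [gcd2_divides] then supplies the factor n+3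
     missing from the first form. *)
  pose x1 : int := \sum_(0 <= j < n.+1)
    (catalan j.+1 * 'C(n, j) * 'C((n.+1 + j).+2, j.+2))%:R * (c ^+ j * d ^+ (n - j)).
  pose x2 : int := \sum_(0 <= j < n.+1)
    (catalan j.+1 * 'C(n.+2, j.+2) * 'C((n.+1 + j).+2, j))%:R * (c ^+ j * d ^+ (n - j)).
  have SE : S = \sum_(0 <= j < n.+1)
    (j.+1 * (2 * j).+3 * n.+2 * catalan j.+1 ^ 2 * 'C((n.+1 + j).+2, (2 * j).+3))%:R
    * toQ (c ^+ j * d ^+ (n - j)).
    under eq_bigr => j _ do rewrite -toQ_cd.
    rewrite -(@sum_M _ _ _ _ _ b0' d0' dE M0 M1 M_rec).
    by apply: eq_bigr => k _; rewrite /toQ !rmorphXn.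
  have S1 : S = (n.+1 * n.+2)%:R * toQ x1.
    rewrite SE toQ_sum mulr_sumr; apply: eq_big_nat => j /andP[_ lej].
    by rewrite sum_M_coef // natrM toQM /toQ; ring.
  have S2 : S = (n.+2 * n.+3)%:R * toQ x2.
    rewrite SE toQ_sum mulr_sumr; apply: eq_big_nat => j /andP[_ lej].
    by rewrite sum_M_coef_sym // natrM toQM /toQ; ring.
  have x12 : n.+1%:R * x1 = n.+3%:R * x2.
    apply: (@intr_inj rat); apply: (@mulfI _ n.+2%:R); first by rewrite pnatr_eq0.
    transitivity S; first by rewrite S1 /toQ; ring.
    by rewrite S2 /toQ; ring.
  have [z /(congr1 toQ) zE] := gcd2_divides _ _ _ x12; exists z.
  have {}zE : (gcdn 2 n.+1)%:R * toQ x1 = n.+3%:R * toQ z.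
    by move: zE; rewrite /toQ !rmorphM /= !rmorph_nat.
  rewrite S1 -/(toQ z).
  transitivity ((gcdn 2 n.+1)%:R * toQ x1 / n.+3%:R).
    by field; natr_neq0 rat.
  by rewrite zE mulrC mulKf // pnatr_eq0.
- have MM : exists z : int, (Mgen n.+1 b c * Mgen n b c)%:~R / b%:~R = z%:~R :> rat.
    have /dvdzP[z ->] := dvdz_Mgen_mul b c n; exists z.
    by rewrite rmorphM mulfK.
  split=> //.
  have := @sum_M_alternating _ _ _ _ M0 M1 M_rec n.
  set S := \sum_(_ <= _ < _) _ => SE.
  transitivity (S / (n.+1 * n.+2 * n.+3)%:R).
    rewrite mulr_suml; apply: eq_bigr => k _; rewrite /toQ.
    by rewrite [((- d) ^+ _)%:~R]rmorphXn rmorphN rmorphXn; ring.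
  apply: (mulfI b0').
  rewrite mulrA SE -[X in _ = _ * (X / _)]/(toQ _) toQM [RHS]mulrC divfK //.
  by field; natr_neq0 rat.
Qed.
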